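(* Let $\mathcal{U}\subseteq\Sigma^{<\omega}$ be the set of all well-formed formulae of set theory that are unstratified (i.e. not stratified), regarded as strings over the alphabet $\Sigma=\{[,\ ],\ \to,\ \forall,\ \doteq,\ \in,\ w,\ \circledast,\ \bot\}$. Then $\mathcal{U}$ is not a context-free language.
   Context: A formal language over a finite alphabet $\Sigma$ is a subset of $\Sigma^{<\omega}$, the set of finite strings over $\Sigma$. A language is context-free if it is the set of all terminal strings generated from the start symbol of some context-free grammar (finite sets of nonterminals and production rules, each rule replacing a single nonterminal by a finite string of terminals and nonterminals). Syntax of set theory: the alphabet consists of the nine symbols $[$, $]$, $\to$, $\forall$, $\doteq$ (equality symbol), $\in$, $w$, $\circledast$, $\bot$. Well-formed formulae are strings defined as follows. (1) Variables: $w$ is a variable; if $\alpha$ is a variable then the string $\alpha\circledast$ is a variable (so the variables are exactly the strings $w\circledast^n$, $n\in\mathbb{N}$). (2) Atomic formulae: $\bot$ is an atomic formula; if $\alpha,\beta$ are variables then $\alpha\doteq\beta$ and $\alpha\in\beta$ are atomic formulae. (3) Formulae: every atomic formula is a formula; if $\varphi,\psi$ are formulae and $\alpha$ is a variable then $[\forall\alpha]\varphi$ and $[\varphi\to\psi]$ are formulae. Stratification: let $\varphi$ be a well-formed formula and $X$ the set of variables appearing in $\varphi$. A stratification of $\varphi$ is a function $\sigma\colon X\to\mathbb{Z}$ such that whenever $x\in y$ appears as a subformula of $\varphi$, $\sigma(x)=\sigma(y)-1$, and whenever $x\doteq y$ appears as a subformula of $\varphi$, $\sigma(x)=\sigma(y)$.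 A formula is stratified if it has a stratification. *)

(* Defs.v *)
From HB Require Import structures.
From Stdlib Require Import Relation_Operators.
From mathcomp Require Import all_boot all_order all_algebra.

Set Implicit Arguments.
Unset Strict Implicit.
Unset Printing Implicit Defensive.

Definition language (T : finType) := seq T -> Prop.

Record cfg (T : finType) := CFG {
  nonterminal : finType;
  start : nonterminal;
  rules : seq (nonterminal * seq (nonterminal + T))
}.

Inductive cfg_step (T : finType) (G : cfg T) :
    seq (nonterminal G + T) -> seq (nonterminal G + T) -> Prop :=
| CfgStep u v (A : nonterminal G) (r : seq (nonterminal G + T)) :
    (A, r) \in rules G -> cfg_step (u ++ inl A :: v) (u ++ r ++ v).

Definition cfg_language (T : finType) (G : cfg T) : language T :=
  fun s => clos_refl_trans _ (@cfg_step T G)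
             [:: inl (start G)] [seq inr a | a <- s].

Definition context_free (T : finType) (L : language T) : Prop :=
  exists G : cfg T, forall s : seq T, L s <-> cfg_language G s.

Inductive symbol :=
  LBrack | RBrack | Arrow | Forall | Doteq | Mem | W | Circledast | Bot.

Definition symbol_to_ord (a : symbol) : 'I_9 :=
  inord (match a with
         | LBrack => 0 | RBrack => 1 | Arrow => 2 | Forall => 3 | Doteq => 4
         | Mem => 5 | W => 6 | Circledast => 7 | Bot => 8
         end).

Definition ord_to_symbol (i : 'I_9) : symbol :=
  nth Bot [:: LBrack; RBrack; Arrow; Forall; Doteq; Mem; W; Circledast; Bot] i.

Lemma symbol_to_ordK : cancel symbol_to_ord ord_to_symbol.
Proof. by case; rewrite /ord_to_symbol inordK. Qed.

HB.instance Definition _ := Finite.copy symbol (can_type symbol_to_ordK).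

Inductive is_variable : seq symbol -> Prop :=
| VarW : is_variable [:: W]
| VarNext a : is_variable a -> is_variable (a ++ [:: Circledast]).

Definition eq_str (a b : seq symbol) := a ++ Doteq :: b.
Definition mem_str (a b : seq symbol) := a ++ Mem :: b.
Definition all_str (a p : seq symbol) := [:: LBrack; Forall] ++ a ++ RBrack :: p.
Definition imp_str (p q : seq symbol) :=
  [:: LBrack] ++ p ++ [:: Arrow] ++ q ++ [:: RBrack].

Inductive is_atomic : seq symbol -> Prop :=
| AtomBot : is_atomic [:: Bot]
| AtomEq a b : is_variable a -> is_variable b -> is_atomic (eq_str a b)
| AtomMem a b : is_variable a -> is_variable b -> is_atomic (mem_str a b).

Inductive is_formula : seq symbol -> Prop :=
| FormAtom p : is_atomic p -> is_formula p
| FormAll a p : is_variable a -> is_formula p -> is_formula (all_str a p)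
| FormImp p q : is_formula p -> is_formula q -> is_formula (imp_str p q).

(* [subformula r p]: r is a subformula of p.  Being a well-formed substring
   would be too weak: [W; Mem; W] is a substring of [W; Mem; W; Circledast]. *)
Inductive subformula : seq symbol -> seq symbol -> Prop :=
| SubRefl p : is_formula p -> subformula p p
| SubAll r a p :
    is_variable a -> subformula r p -> subformula r (all_str a p)
| SubImpL r p q :
    is_formula q -> subformula r p -> subformula r (imp_str p q)
| SubImpR r p q :
    is_formula p -> subformula r q -> subformula r (imp_str p q).

(* An assignment of integers to the variables appearing in p is represented by
   a total function on strings; its values elsewhere are unconstrained. *)
Definition stratification (p : seq symbol) (sigma : seq symbol -> int) : Prop :=
  (forall x y, is_variable x -> is_variable y ->
     subformula (mem_str x y) p -> sigma x = (sigma y - 1)%R) /\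
  (forall x y, is_variable x -> is_variable y ->
     subformula (eq_str x y) p -> sigma x = sigma y).

Definition stratified (p : seq symbol) : Prop :=
  exists sigma : seq symbol -> int, stratification p sigma.

Definition unstratified_formulae : language symbol :=
  fun p => is_formula p /\ ~ stratified p.

(* Main.v *)
Require Import Defs.
From mathcomp Require Import all_boot all_order all_algebra.
From Stdlib Require Import Relation_Operators Operators_Properties.
From mathcomp Require Import zify.
(* MathComp shadows the symbol Mem. *)
Import Defs.

(* The formula [w*^a = w*^b -> [w*^c = w*^a -> w*^b in w*^c]], with a, b, c large
   and far apart, is unstratified, but becomes stratified as soon as the only
   membership no longer joins two variables linked by the equalities. The two
   occurrences of each variable are separated by a long block, and no two
   neighbouring blocks have the same length, so that a short window cannot delete
   stars from both occurrences of a variable. Counting symbols shows that pumping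
   down inside a short window, if it yields a formula at all, deletes only stars,
   in at most two neighbouring blocks; the result is then always stratified. *)

Set Implicit Arguments.
Unset Strict Implicit.
Unset Printing Implicit Defensive.

(** * Short windows in a concatenation of long blocks *)

Section Words.

Variable T : Type.
Implicit Types (s t u m z b : seq T) (B : seq (seq T)).

Lemma cat_eq_cat s1 s2 s3 s4 : s1 ++ s2 = s3 ++ s4 -> size s1 <= size s3 ->
  exists2 t, s3 = s1 ++ t & s2 = t ++ s4.
Proof.
elim: s1 s3 => [|x s1 IH] [|y s3] //=; first by move=> ->; exists [::].
  by move=> ->; exists (y :: s3).
by case=> -> /IH{}IH /IH[t -> ->]; exists t.
Qed.

(** Every inner block has length at least [p], so a window that starts in one block cannot reach
    past the end of the next. The two outermost blocks may be short. *)
Lemma window_in_two_blocks p b0 B bl u m z :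
    all (fun b => p <= size b) B -> size m <= p ->
    u ++ m ++ z = flatten (b0 :: rcons B bl) ->
  exists B1 b b' B2 u' z', [/\ b0 :: rcons B bl = B1 ++ b :: b' :: B2,
    u = flatten B1 ++ u', z = z' ++ flatten B2 & b ++ b' = u' ++ m ++ z'].
Proof.
move=> szB szm; elim: B b0 u szB => [|b1 B IH] b0 u /=.
  rewrite !cats0 => _ def; exists [::], b0, bl, [::], u, z.
  by rewrite /= cats0.
case/andP=> szb1 szB def; case: (leqP (size b0) (size u)) => [le_b0u|lt_ub0].
  have [t def_u def_r] := cat_eq_cat (esym def) le_b0u.
  have [B1 [b [b' [B2 [u' [z' [-> def_t -> def_b]]]]]]] := IH b1 t szB (esym def_r).
  by exists (b0 :: B1), b, b', B2, u', z'; split; rewrite // def_u def_t /= catA.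
have [||z' def_b def_z] := @cat_eq_cat (u ++ m) z (b0 ++ b1) (flatten (rcons B bl)).
- by rewrite -!catA.
- by rewrite !size_cat; lia.
by exists [::], b0, b1, (rcons B bl), u, z'; rewrite def_b -catA.
Qed.

End Words.

(** * Subsequences of blocks that end in a run of one letter *)

Section Subwords.

Variable T : eqType.
Implicit Types (s t L Q : seq T) (a : T).

Lemma subseq_catP s t1 t2 : subseq s (t1 ++ t2) ->
  exists s1 s2, [/\ s = s1 ++ s2, subseq s1 t1 & subseq s2 t2].
Proof.
case/subseqP=> m szm ->; exists (mask (take (size t1) m) t1).
exists (mask (drop (size t1) m) t2); rewrite !mask_subseq; split=> //.
by rewrite -{1}(cat_take_drop (size t1) m) mask_cat ?size_takel ?szm ?size_cat ?leq_addr.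
Qed.

Lemma subseq_nseq s a e : subseq s (nseq e a) -> s = nseq (size s) a /\ size s <= e.
Proof.
move=> ss; split; last by rewrite -(size_nseq e a) size_subseq.
by apply/all_pred1P/allP=> x /(mem_subseq ss); rewrite mem_nseq => /andP[].
Qed.

(** The run supplies only copies of [a], so the letters of [Q] other than [a] all come from [L];
    with [size L] of them nothing of [L] is lost. *)
Lemma subseq_block Q L a e : a \notin L ->
    subseq Q (L ++ nseq e a) -> size L <= count (predC1 a) Q ->
  exists2 e', e' <= e & Q = L ++ nseq e' a.
Proof.
move=> aL /subseq_catP[Q1 [Q2 [-> sQ1 /subseq_nseq[-> le_e]]]].
rewrite size_nseq in le_e.
rewrite count_cat count_nseq /= eqxx addn0 => le_L.
exists (size Q2) => //; congr (_ ++ _); apply/eqP.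
by rewrite -(size_subseq_leqif sQ1).2 eqn_leq size_subseq //= (leq_trans le_L) ?count_size.
Qed.

Lemma count_block L a e : a \notin L -> count (predC1 a) (L ++ nseq e a) = size L.
Proof.
move=> aL; rewrite count_cat count_nseq /= eqxx addn0; apply/eqP.
by rewrite -all_count; apply/allP=> x xL /=; apply: contraNneq aL => <-.
Qed.

(** Neither half of [Q] has more letters other than [a] than its block; equal totals force equality
    in both. *)
Lemma subseq_two_blocks Q L1 L2 a e1 e2 : a \notin L1 -> a \notin L2 ->
    let P := (L1 ++ nseq e1 a) ++ L2 ++ nseq e2 a in
    subseq Q P -> count (predC1 a) Q = count (predC1 a) P ->
  exists e1' e2', [/\ e1' <= e1, e2' <= e2 &
    Q = (L1 ++ nseq e1' a) ++ L2 ++ nseq e2' a].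
Proof.
move=> aL1 aL2 P /subseq_catP[Q1 [Q2 [-> sQ1 sQ2]]].
rewrite !count_cat -!(count_cat _ _ (nseq _ _)) !count_block // => cQ.
have := leq_count_subseq (predC1 a) sQ1; have := leq_count_subseq (predC1 a) sQ2.
rewrite !count_block // => le2 le1.
have [|e1' ? ->] := subseq_block aL1 sQ1; first by lia.
have [|e2' ? ->] := subseq_block aL2 sQ2; first by lia.
by exists e1', e2'.
Qed.

End Subwords.

(** * Pumping down in context-free languages *)

Section Pumping.

Variables (T : finType) (G : cfg T).
Local Notation N := (nonterminal G).
Implicit Types (A B : N) (F : {set N}) (al be r : seq (N + T)) (w : seq T).

(** Parse forests with their yields, in big-step form, so that induction follows the trees instead
    of a sequence of rewritings. *)
Inductive derives : seq (N + T) -> seq T -> Prop :=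
| DerNil : derives [::] [::]
| DerTerm a al w : derives al w -> derives (inr a :: al) (a :: w)
| DerRule A r al w1 w2 : (A, r) \in rules G -> derives r w1 -> derives al w2 ->
    derives (inl A :: al) (w1 ++ w2).

(* Derivations whose parse trees never repeat a nonterminal along a branch; F
   collects the nonterminals met on the way down from the root. *)
Inductive sderives : {set N} -> seq (N + T) -> seq T -> Prop :=
| SderNil F : sderives F [::] [::]
| SderTerm F a al w : sderives F al w -> sderives F (inr a :: al) (a :: w)
| SderRule F A r al w1 w2 : A \notin F -> (A, r) \in rules G ->
    sderives (A |: F) r w1 -> sderives F al w2 ->
    sderives F (inl A :: al) (w1 ++ w2).

Lemma derives_cat al be w1 w2 :
  derives al w1 -> derives be w2 -> derives (al ++ be) (w1 ++ w2).
Proof.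
move=> d1 d2; elim: d1 => //= [a al' w _ IH|A r al' w w' Ar dr _ _ IH].
  exact: DerTerm.
by rewrite -catA; apply: DerRule dr IH.
Qed.

Lemma derives_catP al be w : derives (al ++ be) w ->
  exists w1 w2, [/\ w = w1 ++ w2, derives al w1 & derives be w2].
Proof.
move: {-2}(al ++ be) (erefl (al ++ be)) => ga def d.
elim: d al def => [|a ga' w' d IH|A r ga' w1 w2 Ar dr _ d IH] [|x al] /=.
- by move=> <-; exists [::], [::]; split=> //; apply: DerNil.
- by [].
- by move=> <-; exists [::], (a :: w'); split=> //; [apply: DerNil | apply: DerTerm].
- case=> <- /IH[v1 [v2 [-> d1 d2]]]; exists (a :: v1), v2; split=> //.
  exact: DerTerm.
- move=> <-; exists [::], (w1 ++ w2); split=> //; first exact: DerNil.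
  exact: DerRule dr d.
case=> <- /IH[v1 [v2 [-> d1 d2]]]; exists (w1 ++ v1), v2; rewrite catA; split=> //.
exact: DerRule dr d1.
Qed.

Lemma derives_terminals w : derives [seq inr a | a <- w] w.
Proof. by elim: w => [|a w IH] /=; [apply: DerNil | apply: DerTerm]. Qed.

Lemma cfg_steps_derives al w :
  clos_refl_trans _ (@cfg_step T G) al [seq inr a | a <- w] <-> derives al w.
Proof.
split=> [/clos_rt_rt1n_iff|].
  move def: (map _ w) => be st; elim: st def => {al be} [al <-|al be ga st _ IH def].
    exact: derives_terminals.
  case: st (IH def) => u v A r Ar.
  case/derives_catP=> w1 [_ [-> d1 /derives_catP[w2 [w3 [-> d2 d3]]]]].
  by apply: derives_cat d1 _; apply: DerRule d2 d3.
have ctx u v be ga : clos_refl_trans _ (@cfg_step T G) be ga ->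
    clos_refl_trans _ (@cfg_step T G) (u ++ be ++ v) (u ++ ga ++ v).
  elim=> {be ga} [be ga st|be|be ga de _ st1 _]; last 2 first.
  - exact: rt_refl.
  - exact: rt_trans.
  apply: rt_step; case: st => u' v' A r Ar.
  by rewrite -!catA /= !(catA u); apply: CfgStep.
elim=> {al w} [|a al w _ IH|A r al w1 w2 Ar _ IH1 _ IH2] /=; first exact: rt_refl.
  by have := ctx [:: inr a] [::] _ _ IH; rewrite !cats0.
rewrite map_cat; apply: rt_trans (rt_step _ _ _ _ (CfgStep [::] al Ar)) _.
apply: rt_trans (ctx [::] al _ _ IH1) _.
by have := ctx (map inr w1) [::] _ _ IH2; rewrite !cats0.
Qed.

Lemma sderives_derives F al w : sderives F al w -> derives al w.
Proof.
elim=> {F al w} [F|F a al w _|F A r al w1 w2 _ Ar _ d1 _ d2].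
- exact: DerNil.
- exact: DerTerm.
- exact: DerRule d1 d2.
Qed.

Lemma sderives_cat F al be w1 w2 :
  sderives F al w1 -> sderives F be w2 -> sderives F (al ++ be) (w1 ++ w2).
Proof.
move=> d1 d2; elim: d1 d2 => //= {F al w1} [F a al w _ IH|F A r al w w' AF Ar dr _ _ IH] d2.
  by apply: SderTerm; apply: IH.
by rewrite -catA; apply: SderRule dr (IH d2).
Qed.

Lemma sderives_weaken F F' al w : F' \subset F -> sderives F al w -> sderives F' al w.
Proof.
move=> sF d; elim: d F' sF => {F al w} [F|F a al w _ IH|F A r al w1 w2 AF Ar _ IH1 _ IH2] F' sF.
- exact: SderNil.
- by apply: SderTerm; apply: IH.
apply: SderRule (Ar) _ _; last exact: IH2.
  by apply: contra AF; apply: (subsetP sF).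
by apply: IH1; apply: setUS.
Qed.

(** If some node is labelled [A], its subtree yields a factor [x] and stays free of repetitions when
    fewer labels are forbidden; otherwise [A] can be forbidden throughout. *)
Lemma sderives_avoid A F al w : sderives F al w ->
  sderives (A |: F) al w \/
  exists v x y, w = v ++ x ++ y /\ sderives set0 [:: inl A] x.
Proof.
elim=> {F al w} [F|F a al w _ IH|F B r al w1 w2 BF Br d1 IH1 _ IH2].
- by left; apply: SderNil.
- case: IH => [d|[v [x [y [-> d]]]]]; first by left; apply: SderTerm.
  by right; exists (a :: v), x, y.
case: (eqVneq B A) => [eqBA|neqBA].
  right; exists [::], w1, w2; split=> //; rewrite -eqBA -[w1]cats0.
  apply: SderRule (Br) _ (SderNil _); first by rewrite inE.
  by apply: sderives_weaken d1; apply/setUS/sub0set.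
case: IH1 => [d|[v [x [y [-> d]]]]]; last first.
  by right; exists v, x, (y ++ w2); rewrite -!catA.
case: IH2 => [d'|[v [x [y [-> d']]]]]; last first.
  by right; exists (w1 ++ v), x, y; rewrite -!catA.
left; apply: SderRule (Br) _ d'; first by rewrite !inE negb_or neqBA.
by rewrite setUCA.
Qed.

(** The successor keeps the powers of [K] positive even if all right-hand sides are empty. *)
Let K := (\max_(Ar <- rules G) size Ar.2).+1.

Lemma size_rule A r : (A, r) \in rules G -> size r <= K.
Proof.
move=> Ar; apply: leqW.
by apply: (@leq_bigmax_seq _ (rules G) xpredT (fun Br => size Br.2) (A, r)).
Qed.

(** Each rule applied on the way down adds a new label to [F], so the trees have height at most
    [#|N| - #|F|] and branching at most [K]. *)
Lemma sderives_size F al w :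
  sderives F al w -> size w <= size al * K ^ (#|N| - #|F|).
Proof.
elim=> {F al w} [F|F a al w _ IH|F A r al w1 w2 AF Ar _ IH1 _ IH2] //=.
  by rewrite mulSn -addn1 addnC leq_add // expn_gt0.
rewrite size_cat mulSn leq_add // (leq_trans IH1) // cardsU1 AF add1n.
have ltF : #|F| < #|N|.
  by rewrite -cardsT; apply: proper_card; apply/properP; split; [exact: subsetT | exists A].
by rewrite -(subnSK ltF) expnS leq_mul2r (size_rule Ar) ?orbT.
Qed.

(** The extra factor [K] pays for a root rule whose label may recur below it. *)
Let p := K ^ #|N|.+1.

Definition pumps_down al w := exists u v x y z,
  [/\ w = u ++ (v ++ x ++ y) ++ z, size (v ++ x ++ y) <= p, 0 < size v + size y &
      derives al (u ++ x ++ z)].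

Lemma pumps_down_cat al be ga w1 w2 w3 : derives al w1 -> derives ga w3 ->
  pumps_down be w2 -> pumps_down (al ++ be ++ ga) (w1 ++ w2 ++ w3).
Proof.
move=> d1 d3 [u [v [x [y [z [-> szp vy d2]]]]]].
exists (w1 ++ u), v, x, y, (z ++ w3); split=> //; first by rewrite -!catA.
have := derives_cat d1 (derives_cat d2 d3); by rewrite -!catA.
Qed.

(* In a parse tree whose proper subtrees have no repetition, either the root
   label does not recur, or a recurrence either yields the same word, and then
   replaces the tree, or is the result of a pumping. *)
Lemma derives_simple_or_pumps al w :
  derives al w -> sderives set0 al w \/ pumps_down al w.
Proof.
elim=> {al w} [|a al w d IH|A r al w1 w2 Ar d1 IH1 d2 IH2].
- by left; apply: SderNil.
- case: IH => [d'|pd]; first by left; apply: SderTerm.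
  right; have := pumps_down_cat (derives_terminals [:: a]) DerNil pd.
  by rewrite !cats0.
have dA : derives [:: inl A] w1 by rewrite -[w1]cats0; apply: DerRule d1 DerNil.
case: IH2 => [{}d2|pd]; last first.
  by right; have := pumps_down_cat dA DerNil pd; rewrite !cats0.
case: IH1 => [{}d1|[u [v [x [y [z [-> szp vy d1']]]]]]]; last first.
  right; apply: (pumps_down_cat (be := [:: inl A]) DerNil (sderives_derives d2)).
  exists u, v, x, y, z; split=> //.
  by rewrite -[u ++ x ++ z]cats0; apply: DerRule d1' DerNil.
have szw1 : size w1 <= p.
  apply: leq_trans (sderives_size d1) _; rewrite cards0 subn0 /p expnS.
  by rewrite leq_mul2r (size_rule Ar) ?orbT.
case: (sderives_avoid A d1) => [d1'|[v [x [y [def_w1 dx]]]]].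
  by left; apply: SderRule d1' d2; rewrite ?inE.
case: (posnP (size v + size y)) => [/eqP|vy_gt0].
  rewrite addn_eq0 !size_eq0 => /andP[/eqP v0 /eqP y0].
  by left; rewrite def_w1 v0 y0 cats0; apply: sderives_cat dx d2.
right; apply: (pumps_down_cat (be := [:: inl A]) DerNil (sderives_derives d2)).
exists [::], v, x, y, [::]; rewrite !cats0 -def_w1; split=> //.
exact: sderives_derives dx.
Qed.

End Pumping.

Lemma context_free_pumping_down (T : finType) (L : language T) : context_free L ->
  exists p, forall s, L s -> p < size s -> exists u v x y z,
    [/\ s = u ++ (v ++ x ++ y) ++ z, size (v ++ x ++ y) <= p,
        0 < size v + size y & L (u ++ x ++ z)].
Proof.
case=> G LG; eexists => s /LG/cfg_steps_derives/derives_simple_or_pumps[d|].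
  (* A repetition-free tree over the start symbol has a yield of length at most [K ^ #|N|], too
     short for this word. *)
  move=> /leq_trans/(_ (sderives_size d)); rewrite cards0 subn0 mul1n ltnNge.
  by move/negP; case; apply: leq_pexp2l.
case=> [u [v [x [y [z [-> szp vy d]]]]]] _; exists u, v, x, y, z; split=> //.
exact/LG/cfg_steps_derives.
Qed.

(** * Formulae as strings *)

Definition symbol_code (a : symbol) : nat :=
  match a with
  | LBrack => 0 | RBrack => 1 | Arrow => 2 | Forall => 3 | Doteq => 4
  | Mem => 5 | W => 6 | Circledast => 7 | Bot => 8
  end.

(* The equality inherited from 'I_9 does not compute. *)
Lemma symbol_eqE (a b : symbol) : (a == b) = (symbol_code a == symbol_code b).
Proof. by apply/eqP/eqP => [->|] //; case: a; case: b. Qed.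

Definition var (n : nat) : seq symbol := W :: nseq n Circledast.

Lemma is_variable_var n : is_variable (var n).
Proof.
elim: n => [|n IH]; first exact: VarW.
by rewrite /var -addn1 nseqD -cat_cons; apply: VarNext.
Qed.

Lemma is_variableP a : is_variable a -> exists n, a = var n.
Proof.
elim=> [|_ _ [n ->]]; first by exists 0.
by exists n.+1; rewrite /var -(addn1 n) nseqD.
Qed.

Definition occ (c : symbol) (s : seq symbol) : nat := count_mem c s.

Lemma occ_nil c : occ c [::] = 0.
Proof. by []. Qed.

Lemma occ_cons c a s : occ c (a :: s) = (symbol_code a == symbol_code c) + occ c s.
Proof. by rewrite /occ /= symbol_eqE. Qed.

Lemma occ_cat c s t : occ c (s ++ t) = occ c s + occ c t.
Proof. exact: count_cat. Qed.

Lemma occ_nseq c a n : occ c (nseq n a) = (symbol_code a == symbol_code c) * n.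
Proof. by rewrite /occ count_nseq /= symbol_eqE. Qed.

Definition occE := (occ_nil, occ_cons, occ_cat, occ_nseq).

(** Each implication or quantifier owns one pair of brackets; atoms are the leaves of a tree
    branching at the arrows; [W] occurs once per quantifier and twice per equality or membership. *)
Lemma formula_counts s : is_formula s ->
  [/\ occ LBrack s = occ RBrack s,
      occ LBrack s = occ Arrow s + occ Forall s,
      occ Doteq s + occ Mem s + occ Bot s = (occ Arrow s).+1 &
      occ W s = occ Forall s + (occ Doteq s + occ Mem s).*2].
Proof.
elim=> {s} [_ [|_ _ /is_variableP[n ->] /is_variableP[m ->]|
    _ _ /is_variableP[n ->] /is_variableP[m ->]]|
    _ s /is_variableP[n ->] _ [? ? ? ?]|s t _ [? ? ? ?] _ [? ? ? ?]];
  by rewrite /eq_str /mem_str /all_str /imp_str !occE /=; split; lia.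
Qed.

Lemma count_nonstar s : count (predC1 Circledast) s =
  occ LBrack s + occ RBrack s + occ Arrow s + occ Forall s +
  occ Doteq s + occ Mem s + occ W s + occ Bot s.
Proof.
elim: s => // a s IH; rewrite !occ_cons [LHS]/= IH symbol_eqE.
by case: a => /=; lia.
Qed.

(* Deleting symbols of a segment that does not meet both kinds of brackets
   cannot destroy a bracket, hence no arrow or quantifier, hence no atom. *)
Lemma formula_deletion s P Q t :
    is_formula (s ++ P ++ t) -> is_formula (s ++ Q ++ t) -> subseq Q P ->
    (LBrack \notin P) || (RBrack \notin P) ->
  count (predC1 Circledast) Q = count (predC1 Circledast) P.
Proof.
move=> /formula_counts[p1 p2 p3 p4] /formula_counts[q1 q2 q3 q4] sQP brP.
have le c : occ c Q <= occ c P := leq_count_subseq (pred1 c) sQP.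
move: (le LBrack) (le RBrack) (le Arrow) (le Forall) (le Doteq) (le Mem) (le W) (le Bot).
move: p1 p2 p3 p4 q1 q2 q3 q4; rewrite !count_nonstar !occE.
by case/orP: brP => /count_memPn; rewrite -/(occ _ _) => ->; lia.
Qed.

(** * Tokens, and stratification read off from them *)

Definition tokens_step (a : symbol) (st : nat * seq (symbol * nat)) :=
  if a is Circledast then (st.1.+1, st.2) else (0, (a, st.1) :: st.2).

(* Each symbol other than the star, with the length of the run of stars after it. *)
Definition tokens (s : seq symbol) := (foldr tokens_step (0, [::]) s).2.

Definition starts_nonstar (s : seq symbol) := if s is a :: _ then a != Circledast else false.

Lemma foldr_tokens_step s k l : foldr tokens_step (k, l) s =
  ((foldr tokens_step (k, [::]) s).1, (foldr tokens_step (k, [::]) s).2 ++ l).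
Proof. by elim: s => //= a s ->; case: a. Qed.

Lemma foldr_tokens_nseq n st :
  foldr tokens_step st (nseq n Circledast) = (n + st.1, st.2).
Proof. by elim: n => [|n IH] /=; [case: st | rewrite IH]. Qed.

(** Stars at the front of [t] would lengthen the run of the last token of [s]. *)
Lemma tokens_cat s t : starts_nonstar t -> tokens (s ++ t) = tokens s ++ tokens t.
Proof.
case: t => //= a t; rewrite /tokens foldr_cat /= symbol_eqE.
by case: a => //= _; rewrite foldr_tokens_step.
Qed.

Lemma formula_starts_nonstar s t : is_formula s -> starts_nonstar (s ++ t).
Proof.
case=> [_ [|_ _ /is_variableP[n ->] _|_ _ /is_variableP[n ->] _]||] /=;
  by rewrite ?symbol_eqE.
Qed.

Lemma subformula_formula r s : subformula r s -> is_formula r /\ is_formula s.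
Proof.
elim=> {r s} [s //|r a s va _ [fr fs]|r s t ft _ [fr fs]|r s t fs _ [fr ft]];
  split=> //; [exact: FormAll | exact: FormImp | exact: FormImp].
Qed.

(** A subformula begins with a nonstar and is followed by a nonstar or by the end of the string, so
    no run of stars is cut. *)
Lemma tokens_subformula r s : subformula r s ->
  exists t1 t2, tokens s = t1 ++ tokens r ++ t2.
Proof.
elim=> {r s} [s _|r a s va d [t1 [t2 IH]]|r s t ft d [t1 [t2 IH]]|r s t fs d [t1 [t2 IH]]].
- by exists [::], [::]; rewrite cats0.
- have [_ fs] := subformula_formula d.
  have := @formula_starts_nonstar s [::] fs; rewrite cats0 => ns.
  exists (tokens ([:: LBrack; Forall] ++ a ++ [:: RBrack]) ++ t1), t2.
  by rewrite /all_str -cat_rcons -cats1 !catA tokens_cat // IH !catA.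
- have [_ fs] := subformula_formula d.
  exists (tokens [:: LBrack] ++ t1), (t2 ++ tokens ([:: Arrow] ++ t ++ [:: RBrack])).
  rewrite /imp_str tokens_cat ?formula_starts_nonstar // tokens_cat ?IH ?catA //=.
  by rewrite symbol_eqE.
have [_ ft] := subformula_formula d.
exists (tokens ([:: LBrack] ++ s ++ [:: Arrow]) ++ t1), (t2 ++ tokens [:: RBrack]).
have -> : imp_str s t = ([:: LBrack] ++ s ++ [:: Arrow]) ++ t ++ [:: RBrack].
  by rewrite /imp_str -!catA.
rewrite tokens_cat ?formula_starts_nonstar //.
by rewrite (tokens_cat t) /= ?symbol_eqE // IH !catA.
Qed.

(** The edges that the relation symbol [c] puts between variable indices: the star counts on its two
    sides. *)
Fixpoint links (c : symbol) (l : seq (symbol * nat)) : seq (nat * nat) :=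
  if l is (_, n) :: l' then
    if l' is (d, _) :: (_, m) :: _ then
      if symbol_code d == symbol_code c then (n, m) :: links c l' else links c l'
    else [::]
  else [::].

Lemma links_infix c l1 l2 a n k b m :
  (n, m) \in links c (l1 ++ [:: (a, n), (c, k), (b, m) & l2]).
Proof.
elim: l1 => [|[d i] l1 IH] /=; first by rewrite eqxx inE eqxx.
case: l1 IH => [|[d1 i1] [|[d2 i2] l1]] IH; rewrite /= in IH *.
- by case: ifP => // _; rewrite inE IH orbT.
- by case: ifP => // _; rewrite inE IH orbT.
- by case: ifP => // _; rewrite inE IH orbT.
Qed.

Lemma stratified_formula s (sigma : nat -> int) :
    (forall n m, (n, m) \in links Mem (tokens s) -> sigma n = (sigma m - 1)%R) ->
    (forall n m, (n, m) \in links Doteq (tokens s) -> sigma n = sigma m) ->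
  (* The string [var n] has length [n.+1], so [(size x).-1] recovers the index. *)
  stratified s.
Proof.
move=> memP eqP; exists (fun x => sigma (size x).-1).
split=> _ _ /is_variableP[n ->] /is_variableP[m ->] /tokens_subformula[t1 [t2 def]];
  rewrite /= !size_nseq; [apply: memP | apply: eqP];
  rewrite def /tokens /mem_str /eq_str foldr_cat /= foldr_tokens_nseq /=;
  by rewrite foldr_tokens_nseq /= !addn0 links_infix.
Qed.

(** * The counterexample *)

(** The two occurrences of a variable get separate indices because pumping may shorten only one.
    When they agree, the three atoms form a triangle. *)
Definition triangle a1 b1 c1 a2 b2 c2 :=
  imp_str (eq_str (var a1) (var b1))
    (imp_str (eq_str (var c1) (var a2)) (mem_str (var b2) (var c2))).

Definition block (L : seq symbol) (n : nat) : seq symbol := L ++ nseq n Circledast.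

Lemma size_block L n : size (block L n) = size L + n.
Proof. by rewrite size_cat size_nseq. Qed.

(** Cut after each run of stars; no two neighbouring blocks together contain both kinds of bracket,
    as [formula_deletion] demands. *)
Definition triangle_blocks a1 b1 c1 a2 b2 c2 :=
  [:: block [:: LBrack; W] a1; block [:: Doteq; W] b1; block [:: Arrow; LBrack; W] c1;
      block [:: Doteq; W] a2; block [:: Arrow; W] b2; block [:: Mem; W] c2;
      block [:: RBrack; RBrack] 0].

Lemma flatten_triangle a1 b1 c1 a2 b2 c2 :
  flatten (triangle_blocks a1 b1 c1 a2 b2 c2) = triangle a1 b1 c1 a2 b2 c2.
Proof. by rewrite /triangle /imp_str /eq_str /mem_str /= /block /= -!catA /= -catA /= -catA. Qed.

Lemma is_formula_triangle a1 b1 c1 a2 b2 c2 : is_formula (triangle a1 b1 c1 a2 b2 c2).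
Proof.
apply: FormImp; last apply: FormImp; apply: FormAtom;
  by [apply: AtomEq; apply: is_variable_var | apply: AtomMem; apply: is_variable_var].
Qed.

Lemma unstratified_triangle a b c : ~ stratified (triangle a b c a b c).
Proof.
have v := is_variable_var.
have fE n m : is_formula (eq_str (var n) (var m)) by apply/FormAtom/AtomEq.
have fM n m : is_formula (mem_str (var n) (var m)) by apply/FormAtom/AtomMem.
case=> sigma [memP eqP].
have eab : sigma (var a) = sigma (var b).
  by apply: eqP => //; apply: SubImpL; [apply: FormImp | apply: SubRefl].
have eca : sigma (var c) = sigma (var a).
  by apply: eqP => //; apply: SubImpR => //; apply: SubImpL => //; apply: SubRefl.
have : sigma (var b) = (sigma (var c) - 1)%R.
  by apply: memP => //; do 2!apply: SubImpR => //; apply: SubRefl.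
by rewrite eca eab; lia.
Qed.

Lemma tokens_triangle a1 b1 c1 a2 b2 c2 : tokens (triangle a1 b1 c1 a2 b2 c2) =
  [:: (LBrack, 0); (W, a1); (Doteq, 0); (W, b1); (Arrow, 0); (LBrack, 0);
      (W, c1); (Doteq, 0); (W, a2); (Arrow, 0); (W, b2); (Mem, 0); (W, c2);
      (RBrack, 0); (RBrack, 0)].
Proof.
rewrite -flatten_triangle /tokens /= /block /=.
by do 6!rewrite foldr_cat foldr_tokens_nseq /=; rewrite !addn0.
Qed.

(* S plays the part of the component of c2 in the graph of the two equalities. *)
Lemma stratified_triangle (S : pred nat) a1 b1 c1 a2 b2 c2 :
    S a1 = S b1 -> S c1 = S a2 -> ~~ S b2 -> S c2 ->
  stratified (triangle a1 b1 c1 a2 b2 c2).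
Proof.
move=> Sab Sca /negbTE Sb2 Sc2.
(* Two levels suffice: 1 on [S], 0 elsewhere. *)
apply: (stratified_formula (sigma := fun n => Posz (S n))) => n m;
  rewrite tokens_triangle /= !inE.
  by case/eqP=> -> ->; rewrite Sb2 Sc2.
by case/orP=> /eqP[-> ->]; rewrite ?Sab ?Sca.
Qed.

(** By the symbol counts only stars disappear: at least one since [v] and [y] are not both empty,
    and at most [p] since they lie in the window. *)
Lemma star_deletion B1 L1 n1 L2 n2 B2 u v x y z p :
    let P := block L1 n1 ++ block L2 n2 in
    let Q := u ++ x ++ z in
    P = u ++ (v ++ x ++ y) ++ z -> size (v ++ x ++ y) <= p -> 0 < size v + size y ->
    is_formula (B1 ++ P ++ B2) -> is_formula (B1 ++ Q ++ B2) ->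
    Circledast \notin L1 ++ L2 -> (LBrack \notin L1 ++ L2) || (RBrack \notin L1 ++ L2) ->
  exists m1 m2, [/\ m1 <= n1, m2 <= n2, m1 + m2 < n1 + n2, n1 + n2 <= m1 + m2 + p &
    Q = block L1 m1 ++ block L2 m2].
Proof.
move=> P Q defP szp vy fP fQ; rewrite mem_cat negb_or => /andP[starL1 starL2] brL.
have sQP : subseq Q P.
  rewrite defP /Q cat_subseq // cat_subseq //.
  by apply: subseq_trans (suffix_subseq v _); apply: prefix_subseq.
have brP : (LBrack \notin P) || (RBrack \notin P).
  move: brL; rewrite /P /block !mem_cat !mem_nseq !symbol_eqE /=.
  by rewrite !andbF !orbF.
have cQ := formula_deletion fP fQ sQP brP.
have [m1 [m2 [le1 le2 defQ]]] := subseq_two_blocks starL1 starL2 sQP cQ.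
exists m1, m2; split=> //; move: szp vy (congr1 (@size symbol) defP) (congr1 (@size symbol) defQ);
  by rewrite /P /Q /block !size_cat !size_nseq; lia.
Qed.


Theorem mainTheorem2 : ~ context_free unstratified_formulae.
Proof.
case/context_free_pumping_down=> p /= pump.
(* The gaps exceed [p], so a shortened [b] stays above [a] and a shortened [c] above [b]. *)
have [a [b [c [lt_pa lt_ab lt_bc]]]] : exists a b c, [/\ p < a, a + p < b & b + p < c].
  by exists p.+1, p.+1.*2, (p.+1 * 3); split; lia.
have := pump (triangle a b c a b c) _ _; case.
- by split; [apply: is_formula_triangle | apply: unstratified_triangle].
- by rewrite -flatten_triangle size_cat size_block; lia.
move=> u [v [x [y [z [def szp vy [fQ]]]]]]; apply.
have [||B1 [P1 [P2 [B2 [u' [z' [defB def_u def_z defP]]]]]]] :=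
  @window_in_two_blocks symbol p (block [:: LBrack; W] a)
    [:: block [:: Doteq; W] b; block [:: Arrow; LBrack; W] c; block [:: Doteq; W] a;
        block [:: Arrow; W] b; block [:: Mem; W] c]
    (block [:: RBrack; RBrack] 0) u (v ++ x ++ y) z _ szp.
- by rewrite /= !size_nseq; lia.
- by rewrite -def -flatten_triangle.
subst u z.
have fP : is_formula (flatten B1 ++ (P1 ++ P2) ++ flatten B2).
  have := is_formula_triangle a b c a b c; by rewrite def defP -!catA.
have {}fQ : is_formula (flatten B1 ++ (u' ++ x ++ z') ++ flatten B2).
  by rewrite -!catA in fQ *.
have {fP fQ} del L1 n1 L2 n2 : P1 = block L1 n1 -> P2 = block L2 n2 ->
    Circledast \notin L1 ++ L2 -> (LBrack \notin L1 ++ L2) || (RBrack \notin L1 ++ L2) ->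
  exists m1 m2, [/\ m1 <= n1, m2 <= n2, m1 + m2 < n1 + n2, n1 + n2 <= m1 + m2 + p &
    (flatten B1 ++ u') ++ x ++ z' ++ flatten B2 =
      flatten (B1 ++ block L1 m1 :: block L2 m2 :: B2)].
  move=> defP1 defP2 star br; rewrite {}defP1 {}defP2 in fP defP.
  have [m1 [m2 [le1 le2 lt ge defQ]]] := star_deletion defP szp vy fP fQ star br.
  exists m1, m2; split=> //; rewrite flatten_cat [flatten (_ :: _)]/=.
  by rewrite (catA (block L1 m1)) -defQ !catA.
(* Passing to codes lets the side conditions of [del] be decided by computation. *)
have notin d (L : seq symbol) : (d \notin L) = (symbol_code d \notin map symbol_code L).
  by rewrite mem_map // => d1 d2 /eqP; rewrite -symbol_eqE => /eqP.
(* Seven blocks leave six positions for the window, one for each number of blocks before it. *)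
clear def defP; move: B1 defB del => [|X1 [|X2 [|X3 [|X4 [|X5 [|X6 [|X7 B1]]]]]]] //.
- case=> /esym d1 /esym d2 <- del.
  have [||a1 [b1 [le1 le2 lt ge ->]]] := del _ _ _ _ d1 d2; rewrite ?notin //.
  rewrite [X in stratified X](flatten_triangle a1 b1 c a b c).
  (* The complement of the component of [b]: if [b1] is still [b], then [a1 < a] and [b] is linked
     to [a1] only. *)
  pose S : pred nat := if b1 == b then [pred n | (n != b) && (n != a1)] else predC1 b.
  by apply: (@stratified_triangle S); rewrite /S /=; case: eqP => ? /=; lia.
- case=> <- /esym d1 /esym d2 <- del.
  have [||b1 [c1 [le1 le2 lt ge ->]]] := del _ _ _ _ d1 d2; rewrite ?notin //.
  rewrite [X in stratified X](flatten_triangle a b1 c1 a b c).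
  (* At least one of the two was shortened: either [b1 < b] and [b] is isolated, or [c1 < c] and [c]
     is. *)
  pose S : pred nat := if c1 == c then predC1 b else pred1 c.
  by apply: (@stratified_triangle S); rewrite /S /=; case: eqP => ? /=; lia.
- case=> <- <- /esym d1 /esym d2 <- del.
  have [||c1 [a2 [le1 le2 lt ge ->]]] := del _ _ _ _ d1 d2; rewrite ?notin //.
  rewrite [X in stratified X](flatten_triangle a b c1 a2 b c).
  (* If [c1] is still [c], then [a2 < a] separates the two equalities. *)
  pose S : pred nat := if c1 == c then [pred n | (n == c) || (n == a2)] else pred1 c.
  by apply: (@stratified_triangle S); rewrite /S /=; case: eqP => ? /=; lia.
- case=> <- <- <- /esym d1 /esym d2 <- del.
  have [||a2 [b2 [le1 le2 lt ge ->]]] := del _ _ _ _ d1 d2; rewrite ?notin //.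
  rewrite [X in stratified X](flatten_triangle a b c a2 b2 c).
  (* If [a2] is still [a], then [a < b2 < b] by the gap, so [b2] is on neither side of an
     equality. *)
  pose S : pred nat := if a2 == a then predC1 b2 else [pred n | (n == c) || (n == a2)].
  by apply: (@stratified_triangle S); rewrite /S /=; case: eqP => ? /=; lia.
- case=> <- <- <- <- /esym d1 /esym d2 <- del.
  have [||b2 [c2 [le1 le2 lt ge ->]]] := del _ _ _ _ d1 d2; rewrite ?notin //.
  rewrite [X in stratified X](flatten_triangle a b c a b2 c2).
  (* By the gaps, a shortened [b2] or [c2] is a new variable, absent from both equalities. *)
  pose S : pred nat := if c2 == c then predC1 b2 else pred1 c2.
  by apply: (@stratified_triangle S); rewrite /S /=; case: eqP => ? /=; lia.
- case=> <- <- <- <- <- /esym d1 /esym d2 <- del.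
  have [||c2 [o [le1 le2 lt ge ->]]] := del _ _ _ _ d1 d2; rewrite ?notin //.
  (* The closing brackets carry no stars, so [c2] alone is shortened. *)
  have {le2} o0 : o = 0 by lia.
  rewrite o0 in lt ge *.
  rewrite [X in stratified X](flatten_triangle a b c a b c2).
  pose S : pred nat := pred1 c2.
  by apply: (@stratified_triangle S); rewrite /S /=; lia.
by move/(congr1 size); rewrite /= size_cat /=; lia.
Qed.
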